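(* Let $p\equiv 1\pmod 4$ be a prime with $p>5$, and let $D\subseteq\mathbb Z_p$ be the set of quadratic residues. Let $\mathcal B$ be the collection of sets $b\cap D$ for $b$ ranging over the translates $D+g$ ($g\in\mathbb Z_p$) with $b\ne D$. Let $\infty$ be a new point and let $\mathcal B_\infty$ consist of all members of $\mathcal B$ of size $\frac{p-1}{4}$ together with all members of $\mathcal B$ of size $\frac{p-5}{4}$, each modified by adjoining the point $\infty$. Then $(D\cup\{\infty\},\mathcal B_\infty)$ is a $2$-$(\frac{p+1}{2},\frac{p-1}{4},\frac{p-9}{4})$ adesign.
   Context: A $t$-$(v,k,\lambda)$ adesign is an incidence structure with $v$ points and blocks of size $k$ such that every $t$-subset of points lies in exactly $\lambda$ or exactly $\lambda+1$ blocks, both values occurring. *)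

(* Defs.v *)
From mathcomp Require Import all_boot all_order all_algebra.

Set Implicit Arguments.
Unset Strict Implicit.
Unset Printing Implicit Defensive.

Import GRing.Theory.
Local Open Scope ring_scope.

(* The blocks of an incidence structure form a multiset, given as a sequence
   whose order is irrelevant: a repeated block is counted with its
   multiplicity. *)
Definition is_adesign (T : finType) (t v k lambda : nat)
    (X : {set T}) (B : seq {set T}) : Prop :=
  let deg (S : {set T}) := count (fun b : {set T} => S \subset b) B in
  [/\ #|X| = v,
      forall b : {set T}, b \in B -> b \subset X /\ #|b| = k,
      forall S : {set T}, S \subset X -> #|S| = t ->
        deg S = lambda \/ deg S = lambda.+1,
      exists S : {set T}, [/\ S \subset X, #|S| = t & deg S = lambda] &
      exists S : {set T}, [/\ S \subset X, #|S| = t & deg S = lambda.+1]].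

(* For p prime, 'F_p is the ring of integers mod p. *)
Definition quad_residues (p : nat) : {set 'F_p} :=
  [set x : 'F_p | (x != 0) && [exists y : 'F_p, x == y ^+ 2]].

Definition translates (p : nat) (A : {set 'F_p}) : {set {set 'F_p}} :=
  [set [set x + g | x in A] | g : 'F_p].

(* A collection indexed by the translates b; intersections that happened to
   coincide for different b would be listed separately. *)
Definition residue_blocks (p : nat) : seq {set 'F_p} :=
  let D := quad_residues p in
  [seq b :&: D | b : {set 'F_p} <- enum (translates D) & b != D].

(* The new point infinity is None : option 'F_p. *)
Definition points_infty (p : nat) : {set option 'F_p} :=
  None |: [set Some x | x in quad_residues p].

Definition blocks_infty (p : nat) : seq {set option 'F_p} :=
  [seq [set Some x | x in b] | b : {set 'F_p} <- residue_blocks p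
                             & #|b| == ((p - 1) %/ 4)%N] ++
  [seq None |: [set Some x | x in b] | b : {set 'F_p} <- residue_blocks p
                                     & #|b| == ((p - 5) %/ 4)%N].

(* Main.v *)
(** Write p = 4m + 1.  Since -1 is a square, D :&: (D + g) has m - 1 elements if g
    is a residue and m if g is a nonresidue, by the evaluation of the cyclotomic
    numbers of order 2; hence nonresidues g give the blocks without infinity and
    residues g those with it.  For distinct x, y in D, the blocks through x and y
    correspond, via u = x - g, to the elements u <> x of D :&: (D + (x - y)),
    whether or not infinity was adjoined.  The blocks through x and infinity
    correspond to the residues g with x - g in D, i.e. to D :&: (D + x). *)

Require Import Defs.
From mathcomp Require Import all_boot all_order all_algebra.
From mathcomp Require Import cyclic finfield zify ring.

Import GRing.Theory.
Local Open Scope ring_scope.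

(** * Counting, and generators of finite fields *)

Lemma eq_card_inj (T : finType) (f : T -> T) (A B : {set T}) :
  injective f -> (forall x, (x \in A) = (f x \in B)) -> #|A| = #|B|.
Proof.
by move=> injf eqAB; rewrite -(card_preimset B injf); apply: eq_card => x; rewrite !inE.
Qed.

Lemma count_enum (T : finType) (A : {set T}) (P : pred T) :
  count P (enum A) = #|[set x in A | P x]|.
Proof. by rewrite -sum1_count big_enum_cond -sum1dep_card. Qed.

(** The nonzero elements are [#|F|.-1] distinct roots of unity of that exponent, enough for one of
    them to be primitive. *)
Lemma finField_prim_root (F : finFieldType) :
  exists z : F, (#|F|.-1).-primitive_root z.
Proof.
have F_gt1 : (1 < #|F|)%N := finNzRing_gt1 F.
have cardC1 : size (enum [set~ (0 : F)]) = #|F|.-1.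
  by rewrite -cardE cardsC1.
have/hasP[z _ z_prim] : has (#|F|.-1).-primitive_root (enum [set~ (0 : F)]).
  apply: has_prim_root; rewrite ?enum_uniq ?cardC1 //; first by lia.
  apply/allP => x; rewrite mem_enum !inE => x_neq0; rewrite unity_rootE.
  apply/eqP/(mulfI x_neq0); rewrite -exprS prednK ?expf_card ?mulr1 //; lia.
by exists z.
Qed.

(** * Quadratic residues modulo a prime [4 * m + 1] *)

Section QuadraticResidues.

Variables (p m : nat).
Hypotheses (p_prime : prime p) (pE : p = (4 * m).+1).

Local Notation F := 'F_p.
Local Notation D := (quad_residues p).

Definition quad_nonresidues : {set F} := [set x | (x != 0) && (x \notin D)].

Local Notation N := quad_nonresidues.

Lemma card_Fp1 : #|F|.-1 = (4 * m)%N.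
Proof. by rewrite card_Fp // pE. Qed.

Lemma residue_neq0 (x : F) : x \in D -> x != 0.
Proof. by rewrite inE => /andP[]. Qed.

Lemma residue0 : (0 : F) \in D = false.
Proof. by rewrite inE eqxx. Qed.

Lemma residue1 : (1 : F) \in D.
Proof. by rewrite inE oner_neq0; apply/existsP; exists 1; rewrite expr1n. Qed.

Lemma fermat (x : F) : x != 0 -> x ^+ (4 * m) = 1.
Proof.
move=> x_neq0; apply: (mulfI x_neq0); rewrite mulr1 -exprS -pE.
by rewrite -{2}(expf_card x) card_Fp.
Qed.

Lemma m_gt0 : (0 < m)%N.
Proof. by move: p_prime; rewrite pE; case: m. Qed.

(** For a generator [z], the power [z ^+ i] passes the test only when [i] is even, and halving [i]
    then gives a square root. *)
Lemma euler_criterion (x : F) : x != 0 -> (x \in D) = (x ^+ (2 * m) == 1).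
Proof.
move=> x_neq0; rewrite inE x_neq0 /=; apply/existsP/eqP => [[y /eqP xE]|xm1].
  have y_neq0 : y != 0 by apply: contraNneq x_neq0 => y0; rewrite xE y0 expr0n.
  by rewrite xE -exprM mulnA fermat.
have [z] := finField_prim_root F; rewrite card_Fp1 => z_prim.
have [i xE] := prim_rootP z_prim (fermat x x_neq0).
move/eqP: xm1; rewrite xE -exprM -(prim_order_dvd z_prim).
have -> : (4 * m %| i * (2 * m))%N = (2 %| i)%N.
  by rewrite -(@dvdn_pmul2r (2 * m) 2) ?mulnA // muln_gt0 m_gt0.
by move=> /dvdnP[j ->]; exists (z ^+ j); rewrite exprM.
Qed.

Lemma quadratic_character (x : F) :
  x != 0 -> x ^+ (2 * m) = if x \in D then 1 else -1.
Proof.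
move=> x_neq0; rewrite euler_criterion //; case: eqP => // /eqP xm_neq1.
have := fermat x x_neq0; rewrite (_ : 4 * m = 2 * m * 2)%N; last by lia.
by rewrite exprM => /eqP; rewrite sqrf_eq1 (negPf xm_neq1) => /eqP.
Qed.

Lemma residueM (x y : F) :
  x != 0 -> y != 0 -> (x * y \in D) = ((x \in D) == (y \in D)).
Proof.
move=> x_neq0 y_neq0; rewrite (euler_criterion (x * y)) ?mulf_neq0 // exprMn.
(* With exactly one factor in [D] the characters multiply to [-1]; were this equal to 1, the
   nonresidue would pass Euler's criterion. *)
have N1_neq1 (z : F) : z != 0 -> z \notin D -> (-1 == 1 :> F) = false.
  move=> z_neq0 zN; apply: contraNF zN => /eqP N1_eq1.
  by rewrite euler_criterion // quadratic_character // N1_eq1; case: ifP.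
rewrite !quadratic_character //.
have [xD|xN] := boolP (x \in D); have [yD|yN] := boolP (y \in D);
  rewrite ?mulrNN ?mulr1 ?mul1r ?eqxx //; first exact: N1_neq1 yN.
exact: N1_neq1 xN.
Qed.

Lemma residueN (x : F) : (- x \in D) = (x \in D).
Proof.
have [->|x_neq0] := eqVneq x 0; first by rewrite oppr0.
(* The exponent [2 * m], half of [p - 1], is even. *)
have N1D : -1 \in D.
  by rewrite euler_criterion ?oppr_eq0 ?oner_neq0 // exprM sqrrN !expr1n.
by rewrite -mulN1r residueM ?oppr_eq0 ?oner_neq0 // N1D.
Qed.

Lemma residueV (x : F) : (x^-1 \in D) = (x \in D).
Proof.
have [->|x_neq0] := eqVneq x 0; first by rewrite invr0.
have := residueM x x^-1 x_neq0; rewrite invr_eq0 mulfV // residue1 => /(_ x_neq0).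
by move=> /esym/eqP.
Qed.

(** A generator has order [4 * m], so its power with exponent [2 * m] is not 1. *)
Lemma exists_nonresidue : exists x : F, x \in N.
Proof.
have [z] := finField_prim_root F; rewrite card_Fp1 => z_prim.
have m_pos := m_gt0.
have z_neq0 : z != 0 by rewrite (prim_root_eq0 z_prim); lia.
exists z; rewrite inE z_neq0 euler_criterion // -(prim_order_dvd z_prim).
by apply/negP => /dvdn_leq; lia.
Qed.

(** Multiplication by a nonresidue exchanges the two classes, which therefore share the [4 * m]
    nonzero elements equally. *)
Lemma card_residues : #|D| = (2 * m)%N /\ #|N| = (2 * m)%N.
Proof.
have [z] := exists_nonresidue; rewrite inE => /andP[z_neq0 zN].
have cardDN : #|D| = #|N|.
  apply: (@eq_card_inj _ ( *%R z)); first exact: mulfI.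
  move=> x; rewrite [RHS]inE mulf_eq0 (negPf z_neq0) /=.
  have [->|x_neq0] := eqVneq x 0; first by rewrite residue0.
  by rewrite residueM // (negPf zN); case: (x \in D).
have N_E : N = ~: (0 |: D).
  by apply/setP => x; rewrite in_setC in_setU1 negb_or [LHS]inE.
have := cardsC (0 |: D); rewrite -N_E cardsU1 residue0 -cardDN card_Fp // => cardF.
have half n : (1 + n + n = p)%N -> n = (2 * m)%N by lia.
have cardD := half _ cardF.
by split.
Qed.

Lemma nonresidueE (x : F) : (x \in N) = (x != 0) && (x \notin D).
Proof. by rewrite inE. Qed.

(** * Cyclotomic numbers of order 2 *)

Definition cyclotomic_number (A B : {set F}) := #|[set x in A | x - 1 \in B]|.

Local Notation cyc := cyclotomic_number.

Lemma eq_cyclotomic_number (f : F -> F) (A B A' B' : {set F}) :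
    injective f ->
    (forall x, (x \in A) && (x - 1 \in B) = (f x \in A') && (f x - 1 \in B')) ->
  cyc A B = cyc A' B'.
Proof. by move=> injf eqAB; apply: (@eq_card_inj _ f) => // x; rewrite !inE. Qed.

(** Each [x] with [x - 1] in [B] lies in [D], lies in [N] or is 0; the last case occurs when [-1] is
    in [B]. *)
Lemma cyclotomic_number_sum (B : {set F}) :
  (cyc D B + cyc N B + ((-1)%R \in B))%N = #|B|.
Proof.
pose T := [set x : F | x - 1 \in B].
have -> : #|B| = #|T|.
  by apply/esym/(@eq_card_inj _ (fun x => x - 1)) => [|x]; [exact: addIr | rewrite inE].
rewrite -(cardsID D T) -addnA; congr (_ + _)%N.
  by apply: eq_card => x; rewrite [LHS]in_set [RHS]in_setI [x \in T]in_set andbC.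
rewrite (cardsD1 0 (T :\: D)) addnC; congr (_ + _)%N.
  by rewrite in_setD residue0 [_ \in T]in_set sub0r.
apply: eq_card => x.
rewrite [LHS]in_set in_setD1 in_setD [x \in T]in_set nonresidueE.
by rewrite andbA.
Qed.

(* [x |-> 1 - x] and [x |-> x^-1] show that [cyc N D] equals [cyc D N] and
   [cyc N N] respectively; [cyclotomic_number_sum] then determines them all. *)
Lemma cyclotomic_numbers : cyc D D = m.-1 /\ cyc N N = m.
Proof.
have eqDN : cyc N D = cyc D N.
  apply: (@eq_cyclotomic_number (fun x => 1 - x)) => [x y /addrI/oppr_inj //|x].
  rewrite !nonresidueE addrAC subrr sub0r oppr_eq0 residueN.
  by rewrite -(residueN (1 - x)) opprB andbC.
have eqNN : cyc N N = cyc N D.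
  apply: (@eq_cyclotomic_number GRing.inv) => [|x]; first exact: invr_inj.
  rewrite !nonresidueE invr_eq0 residueV.
  have [//|x_neq0] := eqVneq x 0; have [//|xN] := boolP (x \in D); rewrite /=.
  (* The factor [x^-1] is a nonresidue, so it moves [x - 1] to the other class. *)
  have -> : x^-1 - 1 = - (x - 1) * x^-1 by rewrite opprB mulrBl mul1r mulfV.
  have [->|x1_neq0] := eqVneq (x - 1) 0; first by rewrite oppr0 mul0r residue0.
  rewrite residueM ?oppr_eq0 ?invr_eq0 // residueN residueV (negPf xN).
  by case: (_ \in D).
have [cardD cardN] := card_residues; have := m_gt0.
have := cyclotomic_number_sum D; have := cyclotomic_number_sum N.
(* As [-1] is in [D], the term for 0 is 1 for [D] and 0 for [N]; hence [m.-1] against [m]. *)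
rewrite nonresidueE residueN residue1 andbF cardD cardN.
by split; lia.
Qed.

(** * Intersections of [D] with its translates *)

Definition residue_meet (g : F) : {set F} := [set x in D | x - g \in D].

Lemma residue_meetE (g x : F) : (x \in residue_meet g) = (x \in D) && (x - g \in D).
Proof. exact: in_set. Qed.

(** Division by [g] makes [x - g] and [x] consecutive; it preserves [D] if [g] is a residue and
    sends [D] to [N] otherwise. *)
Lemma card_residue_meet (g : F) : g != 0 ->
  #|residue_meet g| = if g \in D then m.-1 else m.
Proof.
move=> g_neq0; have [cycDD cycNN] := cyclotomic_numbers.
have scale (A : {set F}) : (forall x, (x / g \in A) = (x \in D)) ->
    #|residue_meet g| = cyc A A.
  move=> divA; apply: (@eq_card_inj _ (fun x => x / g)) => [|x].
    by apply: mulIf; rewrite invr_eq0.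
  rewrite residue_meetE [RHS]in_set divA.
  by rewrite (_ : x / g - 1 = (x - g) / g) ?divA // mulrBl mulfV.
case: ifP => [gD|gN]; rewrite -?cycDD -?cycNN; apply: scale => x.
  have [->|x_neq0] := eqVneq x 0; first by rewrite mul0r.
  by rewrite residueM ?invr_eq0 // residueV gD eqb_id.
rewrite nonresidueE mulf_eq0 invr_eq0 (negPf g_neq0) orbF.
have [->|x_neq0] := eqVneq x 0; first by rewrite residue0.
by rewrite residueM ?invr_eq0 // residueV gN; case: (x \in D).
Qed.

Lemma mem_translate (A : {set F}) (g x : F) :
  (x \in [set y + g | y in A]) = (x - g \in A).
Proof.
apply/imsetP/idP => [[y yA ->]|xgA]; first by rewrite addrK.
by exists (x - g); rewrite ?subrK.
Qed.

(** If the translates by distinct [g] and [h] agreed, [D] would meet its translate by [h - g] in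
    [2 * m] elements, more than [m]. *)
Lemma translate_residues_inj : injective (fun g => [set x + g | x in D]).
Proof.
move=> g h eq_gh; apply: contraTeq isT => g_neq_h.
have meetD : residue_meet (h - g) = D.
  apply/setP => x; rewrite residue_meetE; case: (boolP (x \in D)) => //= xD.
  by rewrite opprB addrA -mem_translate -eq_gh mem_translate addrK.
have hg_neq0 : h - g != 0 by rewrite subr_eq0 eq_sym.
have := card_residue_meet _ hg_neq0; have [cardD _] := card_residues.
by have := m_gt0; rewrite meetD cardD; case: ifP; lia.
Qed.

(** Injectivity lets nonzero shifts index the blocks with the right multiplicities. *)
Lemma count_residue_blocks (P : pred {set F}) :
  count P (residue_blocks p) = #|[set g : F | (g != 0) && P (residue_meet g)]|.
Proof.
rewrite /residue_blocks count_map count_filter count_enum.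
rewrite -[RHS](card_imset _ translate_residues_inj).
have meetE g : [set x + g | x in D] :&: D = residue_meet g.
  by apply/setP => x; rewrite in_setI mem_translate residue_meetE andbC.
have translate0 : [set x + 0 | x in D] = D.
  by apply/setP => x; rewrite mem_translate subr0.
have neqD g : ([set x + g | x in D] != D) = (g != 0).
  by rewrite -{2}translate0 (inj_eq translate_residues_inj).
congr #|pred_of_set _|; apply/setP => b; rewrite in_set.
apply/andP/imsetP => [[/imsetP[g _ ->]] /= | [g + ->]].
  by rewrite meetE neqD andbC => gP; exists g => //; rewrite in_set.
rewrite in_set => /andP[g_neq0 gP]; split; first exact: imset_f.
by rewrite /= meetE neqD gP.
Qed.

(** * Degrees of pairs of points *)

Hypothesis m_gt1 : (1 < m)%N.

Lemma count_blocks_infty (P : pred {set option F}) :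
  count P (blocks_infty p) =
    (#|[set g in N | P (Some @: residue_meet g)]| +
     #|[set g in D | P (None |: (Some @: residue_meet g))]|)%N.
Proof.
rewrite /blocks_infty count_cat !count_map !count_filter !count_residue_blocks.
(* The prescribed sizes [m] and [m.-1] differ, so the size of a block reveals the class of its
   shift. *)
have -> : ((p - 1) %/ 4 = m)%N by lia.
have -> : ((p - 5) %/ 4 = m.-1)%N by lia.
congr (_ + _)%N; apply: eq_card => g; rewrite [LHS]in_set [RHS]in_set /=.
  rewrite nonresidueE; have [//|g_neq0] := eqVneq g 0.
  rewrite card_residue_meet //; case: ifP => _; rewrite /= ?eqxx ?andbT //.
  by rewrite (_ : _ == _ = false) ?andbF //; lia.
have [->|g_neq0] := eqVneq g 0; first by rewrite residue0.
rewrite card_residue_meet //; case: ifP => _; rewrite /= ?eqxx ?andbT //.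
by rewrite (_ : _ == _ = false) ?andbF //; lia.
Qed.

Local Notation deg S :=
  (count (fun b : {set option F} => S \subset b) (blocks_infty p)).

Lemma Some_imset (A : {set F}) (x : F) : (Some x \in Some @: A) = (x \in A).
Proof. by rewrite mem_imset // => y z []. Qed.

Lemma None_imset (A : {set F}) : (None \in Some @: A) = false.
Proof. by apply/negP => /imsetP[]. Qed.

Lemma deg_infty (x : F) : x \in D -> deg [set None; Some x] = m.-1.
Proof.
move=> xD; rewrite count_blocks_infty.
have -> : [set g in N | [set None; Some x] \subset Some @: residue_meet g] = set0.
  by apply/setP => g; rewrite [LHS]in_set subUset sub1set None_imset andbF in_set0.
have := card_residue_meet x (residue_neq0 x xD); rewrite xD cards0 add0n => <-.
apply: eq_card => g; rewrite [LHS]in_set subUset !sub1set !in_setU !in_set1 eqxx /=.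
by rewrite Some_imset !residue_meetE xD -(residueN (x - g)) opprB.
Qed.

Lemma deg_residues (x y : F) : x \in D -> y \in D -> x != y ->
  deg [set Some x; Some y] = if x - y \in D then m.-2 else m.-1.
Proof.
move=> xD yD x_neq_y; rewrite count_blocks_infty.
have xy_neq0 : x - y != 0 by rewrite subr_eq0.
have := card_residue_meet _ xy_neq0.
(* The element [x] lies in the intersection because [x - (x - y) = y]; it corresponds to the
   excluded shift 0 and costs one. *)
rewrite (cardsD1 x) residue_meetE xD opprB addrC subrK yD => cardxy.
(* The shifts of both classes whose blocks pass through [x] and [y]. *)
pose G := [set g | (g != 0) && (x - g \in D) && (y - g \in D)].
suff [-> cardG] : (#|[set g in N | [set Some x; Some y] \subset Some @: residue_meet g]|
   + #|[set g in D | [set Some x; Some y] \subset None |: (Some @: residue_meet g)]|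
   = #|G|)%N /\ #|G| = #|residue_meet (x - y) :\ x|.
  by rewrite cardG; move: cardxy; case: ifP => _ /= <-.
split.
  rewrite -(cardsID D G) addnC; congr (_ + _)%N; apply: eq_card => g.
    rewrite [LHS]in_set in_setI subUset !sub1set !in_setU !in_set1 /=.
    rewrite !Some_imset !residue_meetE xD yD /= [g \in G]in_set.
    by have [->|] := eqVneq g 0; rewrite ?residue0 // andbC.
  rewrite [LHS]in_set in_setD subUset !sub1set !Some_imset !residue_meetE xD yD.
  by rewrite [g \in G]in_set nonresidueE; case: (g != 0); rewrite ?andbF.
apply: (@eq_card_inj _ (fun g => x - g)) => [g h /addrI/oppr_inj //|g].
rewrite [LHS]in_set in_setD1 residue_meetE.
have -> : x - g - (x - y) = y - g by ring.
have -> : (x - g == x) = (g == 0) by rewrite -subr_eq0 addrAC subrr sub0r oppr_eq0.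
by rewrite andbA.
Qed.

Lemma blocks_inftyP (b : {set option F}) :
  b \in blocks_infty p -> b \subset points_infty p /\ #|b| = m.
Proof.
have block_sub (r : {set F}) : r \in residue_blocks p -> r \subset D.
  by case/mapP=> t _ ->; rewrite subsetIr.
have Some_sub (r : {set F}) : r \subset D -> Some @: r \subset points_infty p.
  by move=> rD; rewrite (subset_trans (imsetS _ rD)) ?subsetUr.
have card_Some (r : {set F}) : #|Some @: r| = #|r| by rewrite card_imset // => x y [].
rewrite mem_cat => /orP[] /mapP[r] /[!mem_filter] /andP[/eqP rE /block_sub rD] ->.
  by rewrite card_Some rE; split; [exact: Some_sub | lia].
rewrite cardsU1 None_imset card_Some rE; split; last by lia.
by rewrite subUset sub1set setU11 Some_sub.
Qed.

Lemma card_points_infty : #|points_infty p| = (2 * m).+1.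
Proof.
rewrite cardsU1 None_imset card_imset => [|x y []//].
by have [-> _] := card_residues.
Qed.

Lemma mem_points_infty (x : F) : (Some x \in points_infty p) = (x \in D).
Proof. by rewrite in_setU1 Some_imset. Qed.

Lemma deg_pair (S : {set option F}) :
  S \subset points_infty p -> #|S| = 2 -> deg S = m.-2 \/ deg S = m.-1.
Proof.
move=> /subsetP subS /eqP/cards2P[a [b [a_neq_b SE]]]; rewrite SE in subS *.
have := subS b (set22 a b); have := subS a (set21 a b).
case: a b a_neq_b {subS SE} => [x|] [y|] //.
- rewrite !mem_points_infty => x_neq_y xD yD; rewrite deg_residues //.
  by case: ifP; [left | right].
- by rewrite mem_points_infty setUC => _ xD _; right; apply: deg_infty.
- by rewrite mem_points_infty => _ _ yD; right; apply: deg_infty.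
Qed.

(** A pair of residues whose difference 1 is again a residue attains the lower degree. *)
Lemma consecutive_residues : exists2 x : F, x \in D & x - 1 \in D.
Proof.
have : (0 < #|residue_meet 1%R|)%N.
  by rewrite card_residue_meet ?oner_neq0 // residue1; lia.
by case/card_gt0P=> x; rewrite residue_meetE => /andP[xD x1D]; exists x.
Qed.

End QuadraticResidues.

Local Close Scope ring_scope.

Theorem theorem4 (p : nat) (p_prime : prime p) (p_mod4 : p = 1 %[mod 4])
    (p_gt5 : 5 < p) :
  is_adesign 2 ((p + 1) %/ 2) ((p - 1) %/ 4) ((p - 9) %/ 4)
    (points_infty p) (blocks_infty p).
Proof.
have [m pE] : exists m, p = (4 * m).+1 by exists (p %/ 4)%N; lia.
have m_gt1 : (1 < m)%N by lia.
have -> : ((p + 1) %/ 2 = (2 * m).+1)%N by lia.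
have -> : ((p - 1) %/ 4 = m)%N by lia.
have -> : ((p - 9) %/ 4 = m.-2)%N by lia.
(* Since [m > 1], the truncated predecessors are true subtractions. *)
rewrite /is_adesign (_ : m.-2.+1 = m.-1); last by lia.
split.
- exact: card_points_infty.
- exact: blocks_inftyP.
- exact: deg_pair.
- have [x xD x1D] := consecutive_residues p m p_prime pE m_gt1.
  have x_neq : x != (x - 1)%R by rewrite -subr_eq0 subKr oner_neq0.
  exists [set Some x; Some (x - 1)%R]; split.
  + by rewrite subUset !sub1set !mem_points_infty xD.
  + by rewrite cards2 (inj_eq (@Some_inj _)) x_neq.
  + by rewrite (deg_residues p m) // subKr residue1.
(* Pairs through infinity all have the higher degree. *)
- exists [set None; Some 1%R]; split; rewrite ?cards2 //.
  + by rewrite subUset !sub1set mem_points_infty residue1 setU11.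
  + by apply: deg_infty; rewrite ?residue1.
Qed.
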